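(* If $G$ is a $T_1$ paratopological group with a suitable set, then $d(G)\le\psi(G)e(G)$. Moreover, if $G$ has a closed suitable set, then $d(G)\le e(G)$.
   Context: A paratopological group is a group $G$ endowed with a topology such that the group operation $G\times G\to G$ is continuous (inversion need not be continuous). Denote the identity element of $G$ by $1_G$. A subset $S$ of a paratopological group $G$ is a suitable set for $G$ if $S$ is a discrete subspace of $G$, $S\cup\{1_G\}$ is closed in $G$, and the subgroup $\langle S\rangle$ generated by $S$ is dense in $G$. A closed suitable set is a suitable set that is closed in $G$. For a space $X$: the density $d(X)$ is the smallest cardinality of a dense subset of $X$; the pseudocharacter $\psi(X)$ is the smallest infinite cardinal $\kappa$ such that for any point $x\in X$ the set $\{x\}$ is an intersection of at most $\kappa$ open subsets of $X$; the extent $e(X)$ is the supremum of the cardinalities of closed discrete subspaces of $X$. *)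

(* Defs.v *)
From HB Require Import structures.
From mathcomp Require Import all_boot all_order all_algebra.
From mathcomp Require Import all_classical all_reals all_analysis.

Set Implicit Arguments.
Unset Strict Implicit.
Unset Printing Implicit Defensive.

Local Open Scope classical_set_scope.
Local Open Scope card_scope.

(* Cardinals are represented by types, compared by [#<=] and [#=] on their full
   sets, and the product of two cardinals by the product type.  The cardinal
   [least_card P] is meaningful only when some type satisfies [P] and [P] is
   invariant under equipotence; [least_cardP] then applies. *)

Definition is_least_card (P : Type -> Prop) (K : Type) : Prop :=
  P K /\ forall L : Type, P L -> [set: K] #<= [set: L].

Definition least_card (P : Type -> Prop) : Type :=
  if pselect (exists K, is_least_card P K) is left h then sval (cid h)
  else False.

Definition card_invariant (P : Type -> Prop) : Prop :=
  forall K L : Type, [set: K] #= [set: L] -> P K -> P L.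

Lemma ex_least_set (T : Type) (P : set (set T)) (A0 : set T) : P A0 ->
  exists A, P A /\ forall B, P B -> A #<= B.
Proof.
move=> PA0; have [A00|A0n0] := pselect (A0 = set0).
  by exists set0; split; [rewrite -A00|move=> B _; exact: card_ge0].
have [t0 _] : A0 !=set0 by apply/set0P/eqP.
pose good (F : set (set T -> T)) :=
  (forall f, F f -> forall A, P A -> A (f A)) /\
  (forall f g A, F f -> F g -> P A -> f A = g A -> f = g).
have [F [[Fin Finj] Fmax]] : exists F, good F /\ forall G, F `<` G -> ~ good G.
  apply: Zorn_bigcup => C Cgood Ctot; split.
    by move=> f [F CF Ff]; exact: (Cgood F CF).1.
  move=> f g A [F CF Ff] [G CG Gg].
  have [FG|GF] := Ctot F G CF CG.
    by apply: (Cgood G CG).2 => //; exact: FG.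
  by apply: (Cgood F CF).2 => //; exact: GF.
have [A [PA Aim]] : exists A, P A /\ A `<=` (fun f => f A) @` F.
  apply: contrapT => /forallNP noA.
  have pick (A : set T) : exists a, P A -> A a /\ ~ ((fun f => f A) @` F) a.
    have [PA|nPA] := pselect (P A); last by exists t0.
    have /existsNP[a /not_implyP aP] :
      ~ (forall a, A a -> ((fun f => f A) @` F) a).
      by move=> h; apply: (noA A); split.
    by exists a.
  have [f fP] := choice pick.
  apply: (Fmax (F `|` [set f])).
    split; first by move=> g Fg; left.
    move=> FfF; have Ff : F f by apply: FfF; right.
    by case: (fP A0 PA0) => _; apply; exists f.
  split.
    by move=> g [/Fin//|-> A PA]; exact: (fP A PA).1.
  move=> g h A [Fg|->] [Fh|->] PA // e.
  - exact: Finj e.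
  - by case: (fP A PA) => _ []; exists g.
  - by case: (fP A PA) => _ []; exists h.
exists A; split=> // B PB.
have AF : A #<= F.
  exact: card_le_trans (subset_card_le Aim) (card_image_le (fun f => f A) F).
have FB : (fun f : set T -> T => f B) @` F #= F.
  by apply: inj_card_eq => f g /set_mem Ff /set_mem Fg; exact: Finj.
apply: card_le_trans AF _; rewrite -(card_le_eql FB).
by apply: subset_card_le => _ [f Ff <-]; exact: (Fin f Ff B PB).
Qed.

Lemma card_le_total (T U : Type) (A : set T) (B : set U) :
  (A #<= B) \/ (B #<= A).
Proof.
have inlA : @inl T U @` A #= A by apply: inj_card_eq => x y _ _ [].
have inrB : @inr T U @` B #= B by apply: inj_card_eq => x y _ _ [].
have [C [CAB Cle]] : exists C, [set @inl T U @` A; @inr T U @` B] C /\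
    forall D, [set @inl T U @` A; @inr T U @` B] D -> C #<= D.
  by apply: (ex_least_set (A0 := @inl T U @` A)); left.
case: CAB => e; [left|right].
  have := Cle _ (or_intror erefl).
  by rewrite e (card_le_eql inlA) (card_le_eqr inrB).
have := Cle _ (or_introl erefl).
by rewrite e (card_le_eql inrB) (card_le_eqr inlA).
Qed.

Lemma least_cardP (P : Type -> Prop) :
  card_invariant P -> (exists K, P K) -> is_least_card P (least_card P).
Proof.
move=> Pinv [K0 PK0]; rewrite /least_card.
case: pselect => [h|[]]; first exact: svalP (cid h).
have PT : P (set_type [set: K0]).
  by apply: (Pinv K0) => //; rewrite card_eq_sym; exact: card_setT.
have [A [PA Ale]] := @ex_least_set K0 [set A | P (set_type A)] setT PT.
exists (set_type A); split=> // L PL.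
rewrite (card_le_eql (card_setT A)).
have [LK|KL] := card_le_total [set: L] [set: K0]; last first.
  exact: card_le_trans (card_leT A) KL.
have [B BL] : exists B : set K0, B #= [set: L].
  have /card_leP[f] := LK.
  pose g (x : L) := val (f (SigSub (mem_set (I : [set: L] x)))).
  exists (g @` setT); apply: inj_card_eq => x y _ _ /val_inj e.
  have : SigSub (mem_set (I : [set: L] x)) = SigSub (mem_set (I : [set: L] y)).
    by apply: (@inj _ _ _ f) => //; rewrite inE.
  by case.
rewrite -(card_le_eqr BL); apply: Ale; apply: (Pinv L) => //.
by rewrite card_eq_sym (card_eql (card_setT B)).
Qed.

Local Open Scope group_scope.

HB.mixin Record Topological_isParatopologicalGroup G
    of Group G & Topological G := {
  mulg_continuous : continuous (fun xy : G * G => xy.1 * xy.2)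
}.

#[short(type="paratopologicalGroupType")]
HB.structure Definition ParatopologicalGroup :=
  {G of Group G & Topological G & Topological_isParatopologicalGroup G}.

Definition discrete_subspace (X : topologicalType) (S : set X) : Prop :=
  forall B : set (set_type S), open B.

Definition generated_subgroup (G : groupType) (S : set G) : set G :=
  smallest (fun H : set G => group_closed (mem H)) S.

Definition suitable_set (G : paratopologicalGroupType) (S : set G) : Prop :=
  [/\ discrete_subspace S,
      closed (S `|` [set 1]) &
      dense (generated_subgroup S)].

Definition closed_suitable_set (G : paratopologicalGroupType) (S : set G) : Prop :=
  suitable_set S /\ closed S.

Section CardinalFunctions.
Variable X : topologicalType.

Definition is_dense_card (K : Type) : Prop :=
  exists D : set X, dense D /\ D #= [set: K].

Definition density : Type := least_card is_dense_card.

Definition pseudocharacter_bound (K : Type) : Prop :=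
  infinite_set [set: K] /\
  forall x : X, exists F : set (set X),
    [/\ F #<= [set: K], F `<=` open & \bigcap_(U in F) U = [set x]].

Definition pseudocharacter : Type := least_card pseudocharacter_bound.

(* The supremum of a family of cardinals is its least upper bound. *)
Definition extent_bound (K : Type) : Prop :=
  forall C : set X, closed C -> discrete_subspace C -> C #<= [set: K].

Definition extent : Type := least_card extent_bound.

Lemma densityP : is_least_card is_dense_card density.
Proof.
apply: least_cardP.
  by move=> K L KL [D [dD DK]]; exists D; split=> //; exact: card_eq_trans DK KL.
exists X; exists setT; split; last exact: card_eqxx.
by move=> O [x Ox] _; exists x.
Qed.

Lemma extentP : is_least_card extent_bound extent.
Proof.
apply: least_cardP.
  by move=> K L KL KP C cC dC; rewrite -(card_le_eqr KL); exact: KP.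
by exists X => C _ _; exact: card_leT.
Qed.

(* Without the T1 axiom no cardinal satisfies [pseudocharacter_bound]. *)
Lemma pseudocharacterP : accessible_space X ->
  is_least_card pseudocharacter_bound pseudocharacter.
Proof.
move=> T1; apply: least_cardP.
  move=> K L KL [Koo KP]; split.
    by move=> Lfin; apply: Koo; rewrite (eq_finite_set KL).
  move=> x; have [F [FK Fo Fx]] := KP x; exists F; split=> //.
  by rewrite -(card_le_eqr KL).
exists (nat + X)%type; split.
  apply/infiniteP; have : [set: nat] #<= [set: nat + X].
    have /card_eqPle[_ h] : @inl nat X @` setT #= [set: nat].
      by apply: inj_card_eq => x y _ _ [].
    by apply: card_le_trans h (card_leT _).
  by [].
move=> x; exists [set ~` [set y] | y in ~` [set x]]; split.
- apply: card_le_trans (card_image_le _ _) _.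
  have /card_eqPle[_ h] : @inr nat X @` (~` [set x]) #= ~` [set x].
    by apply: inj_card_eq => y z _ _ [].
  exact: card_le_trans h (card_leT _).
- by move=> _ [y _ <-]; apply/closed_openC/accessible_closed_set1.
- apply/seteqP; split=> [z zU|_ -> _ [y yx <-] //].
    apply: contrapT => zx; apply: (zU (~` [set z])) => //.
    by exists z.
  by move=> e; apply: yx.
Qed.

End CardinalFunctions.

(* Main.v *)
(* Removing the identity from a suitable set S does not change the subgroup it
   generates.  If {1} is the intersection of a family F of open sets, then
   S \ {1} is the union of the sets S \ U = (S u {1}) \ U with U in F, each of
   which is closed and discrete; hence S \ {1} has at most psi(G) e(G) elements.
   A subgroup generated by at most kappa elements, kappa infinite, has at most
   kappa elements, since there are kappa finite words over kappa letters.  In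
   the closed case S itself has at most e(G) elements, and e(G) is infinite
   unless G is finite, because finite subsets of a T1 space are closed and
   discrete. *)
Require Import Defs.
From mathcomp Require Import all_boot all_order all_algebra.
From mathcomp Require Import all_classical all_reals all_analysis.

Set Implicit Arguments.
Unset Strict Implicit.
Unset Printing Implicit Defensive.

Local Open Scope classical_set_scope.
Local Open Scope card_scope.

Lemma card_le_ex_inj (T U : Type) (A : set T) (B : set U) (u0 : U) :
  A #<= B -> exists f : T -> U, set_fun A B f /\ set_inj A f.
Proof.
move=> /card_leP[f].
pose g x := if pselect (A x) is left Ax
  then val (f (SigSub (mem_set Ax))) else u0.
exists g; split=> [x Ax|x y]; rewrite /g.
  by case: pselect => // Ax'; apply/set_mem/(valP (f _)).
rewrite !inE => Ax Ay; case: pselect => // Ax'; case: pselect => // Ay'.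
move=> /val_inj /(@inj _ _ _ f); rewrite !inE => /(_ I I).
by case.
Qed.

Lemma set_inj_card_le (T U : Type) (A : set T) (B : set U) (f : T -> U) :
  set_fun A B f -> set_inj A f -> A #<= B.
Proof.
move=> fAB finj; rewrite -(card_le_eql (inj_card_eq finj)).
by apply: subset_card_le => _ [x Ax <-]; exact: fAB.
Qed.

(** * Finite words over an infinite alphabet *)

Section WordCodes.
Variable K : Type.
Implicit Types (A C : set K) (s t : seq K) (R : set (seq K * K)).

Definition code_alphabet R : set K := [set x | exists y, R ([:: x], y)].

(* A code is a relation, a word having possibly several codes, so that Zorn's
   lemma applies to inclusion; the empty word is left out so that the empty
   relation, the union of the empty chain, is a code. *)
Definition word_code R : Prop :=
  [/\ forall s y, R (s, y) ->
        all (mem (code_alphabet R)) s /\ code_alphabet R y,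
      forall s, s <> [::] -> all (mem (code_alphabet R)) s ->
        exists y, R (s, y) &
      forall s t y, R (s, y) -> R (t, y) -> s = t].

Lemma all_mem_sub A C s : A `<=` C -> all (mem A) s -> all (mem C) s.
Proof. by move=> AC; apply: sub_all => x; rewrite !inE => /AC. Qed.

Lemma code_alphabet_sub R R' :
  R `<=` R' -> code_alphabet R `<=` code_alphabet R'.
Proof. by move=> RR' x [y Rxy]; exists y; exact: RR'. Qed.

(** A word has finitely many letters, so some member of the chain has all of them in its alphabet
    and already codes the word. *)
Lemma word_code_bigcup (F : set (set (seq K * K))) :
  F `<=` word_code -> total_on F subset -> word_code (\bigcup_(R in F) R).
Proof.
move=> Fcode Ftot; set U := \bigcup_(R in F) R.
have sub R : F R -> code_alphabet R `<=` code_alphabet U.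
  by move=> FR; apply: code_alphabet_sub => p Rp; exists R.
have cover s : s <> [::] -> all (mem (code_alphabet U)) s ->
    exists2 R, F R & all (mem (code_alphabet R)) s.
  elim: s => [//|x [|y s] IH] _.
    rewrite /= andbT inE => -[z [R FR Rxz]]; exists R => //.
    by rewrite /= andbT inE; exists z.
  move=> /andP[]; rewrite inE => -[z [R FR Rxz]] /IH[//|R' FR' ysR'].
  have xR : code_alphabet R x by exists z.
  have [RR'|R'R] := Ftot R R' FR FR'.
    exists R' => //; apply/andP; split=> //.
    by rewrite inE; exact: code_alphabet_sub RR' x xR.
  exists R => //; apply/andP; split; first by rewrite inE.
  exact: all_mem_sub (code_alphabet_sub R'R) ysR'.
split.
- move=> s y [R FR /(let: And3 h _ _ := Fcode R FR in h)[sR yR]].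
  by split; [exact: all_mem_sub (sub R FR) sR|exact: sub FR y yR].
- move=> s s0 /(cover s s0)[R FR sR].
  have [_ /(_ s s0 sR)[y Ry] _] := Fcode R FR.
  by exists y; exists R.
- move=> s t y [R FR Rs] [R' FR' R't].
  have [RR'|R'R] := Ftot R R' FR FR'.
    by have [_ _ h] := Fcode R' FR'; apply: h R't; exact: RR'.
  by have [_ _ h] := Fcode R FR; apply: h Rs _; exact: R'R.
Qed.

(** Choosing one code per word turns the relation, suited to Zorn's lemma, into a function that can
    be composed. *)
Lemma word_code_fun R : word_code R -> K -> exists f : seq K -> K,
  (forall s, s <> [::] -> all (mem (code_alphabet R)) s -> R (s, f s)) /\
  (forall s t, s <> [::] -> all (mem (code_alphabet R)) s ->
     t <> [::] -> all (mem (code_alphabet R)) t -> f s = f t -> s = t).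
Proof.
move=> [_ Rex Rinj] k0.
have /choice[f fP] s : exists y,
    s <> [::] -> all (mem (code_alphabet R)) s -> R (s, y).
  have [[s0 sR]|h] := pselect (s <> [::] /\ all (mem (code_alphabet R)) s).
    by have [y Ry] := Rex s s0 sR; exists y.
  by exists k0 => s0 sR; case: h.
exists f; split=> // s t s0 sR t0 tR e.
by apply: (Rinj s t (f s)); [exact: fP|rewrite e; exact: fP].
Qed.

(** This code serves to show that a maximal code has a nonempty alphabet; [pickle] numbers the words
    over [nat]. *)
Lemma word_code_nat (g : nat -> K) : injective g ->
  exists2 R, word_code R & code_alphabet R = range g.
Proof.
move=> ginj.
pose R := [set p | exists s : seq nat,
  [/\ s <> [::], p.1 = map g s & p.2 = g (pickle s)]].
have allg s : all (mem (range g)) s -> exists u, s = map g u.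
  elim: s => [|x s IH] /=; first by exists [::].
  move=> /andP[/set_mem[n _ <-] /IH[u ->]].
  by exists (n :: u).
have AR : code_alphabet R = range g.
  apply/seteqP; split=> [x [y [u [_ /= + _]]]|_ [n _ <-]].
    by case: u => // n [] // [->]; exists n.
  by exists (g (pickle [:: n])); exists [:: n].
exists R => //; rewrite /word_code AR; split.
- move=> s y [u [_ /= -> ->]]; split; last by exists (pickle u).
  by rewrite all_map; apply/allP => n _; rewrite /= mem_set //; exists n.
- move=> s s0 /allg[u e]; exists (g (pickle u)); exists u; split=> //.
  by move=> u0; apply: s0; rewrite e u0.
- move=> s t y [u [_ /= -> ->]] [v [_ /= ->]] /ginj.
  by move=> /(pcan_inj pickleK) ->.
Qed.

(* Letters outside A are told apart from those of A by being doubled. *)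
Lemma ex_inj_setU A C (f : seq K -> K) :
  (forall s, s <> [::] -> all (mem A) s -> A (f s)) ->
  (forall s t, s <> [::] -> all (mem A) s -> t <> [::] -> all (mem A) t ->
     f s = f t -> s = t) ->
  C #<= A -> (forall x, C x -> ~ A x) -> K ->
  exists e : K -> K, set_fun (A `|` C) A e /\ set_inj (A `|` C) e.
Proof.
move=> fA finj CA CnA k0.
have [h [hCA hinj]] := card_le_ex_inj k0 CA.
pose w x := if x \in A then [:: x] else [:: h x; h x].
have w0 x : w x <> [::] by rewrite /w; case: ifP.
have wA x : (A `|` C) x -> all (mem A) (w x).
  move=> ACx; rewrite /w; case: ifPn => [/= ->//|xA].
  have hx : A (h x) by apply: hCA; case: ACx => //; rewrite notin_setE in xA.
  by rewrite /= !mem_set.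
exists (f \o w); split=> [x ACx /=|x y]; first by apply: fA; [|exact: wA].
rewrite !inE => ACx ACy /= /finj e.
have {e} := e (w0 x) (wA x ACx) (w0 y) (wA y ACy).
rewrite /w; case: ifPn => xA; case: ifPn => yA // -[] // hxy _.
move: xA yA; rewrite !notin_setE => xA yA.
by apply: hinj => //; rewrite inE; [case: ACx|case: ACy].
Qed.

(* Words over the enlarged alphabet are folded into words over the old one,
   whose codes are then moved into the disjoint copy C. *)
Lemma word_code_extend R C : word_code R -> C !=set0 ->
  (forall x, C x -> ~ code_alphabet R x) -> C #= code_alphabet R ->
  exists R', R `<` R' /\ word_code R'.
Proof.
move=> Rcode [c0 Cc0] CnA CA; set A := code_alphabet R in CnA CA.
have [Rsub Rex Rinj] := Rcode.
have [f [fR finj]] := word_code_fun Rcode c0.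
have fA s : s <> [::] -> all (mem A) s -> A (f s).
  by move=> s0 /(fR s s0)/Rsub[].
have /card_eqPle[CleA AleC] := CA.
have [e [eA einj]] := ex_inj_setU fA finj CleA CnA c0.
have [j [jC jinj]] := card_le_ex_inj c0 AleC.
pose D := A `|` C.
have mapA s : all (mem D) s -> all (mem A) (map e s).
  by rewrite all_map; apply: sub_all => x; rewrite !inE => /eA.
have map0 s : s <> [::] -> map e s <> [::] by case: s.
pose R' := R `|` [set p | [/\ p.1 <> [::], all (mem D) p.1,
  ~~ all (mem A) p.1 & p.2 = j (f (map e p.1))]].
have AD : code_alphabet R' = D.
  apply/seteqP; split=> x.
    move=> [y [Rxy|[_ /= + _ _]]]; first by left; exists y.
    by rewrite andbT inE.
  move=> [[y Rxy]|Cx]; first by exists y; left.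
  exists (j (f (map e [:: x]))); right; split=> //=.
    by rewrite andbT inE; right.
  by rewrite andbT notin_setE; exact: CnA.
exists R'; split.
  split; first exact: subsetUl.
  move=> /code_alphabet_sub; rewrite AD => /(_ c0) h.
  by apply: (CnA c0) => //; apply: h; right.
rewrite /word_code AD; split.
- move=> s y [/Rsub[sA yA]|[/= s0 sD _ ->]].
    by split; [apply: all_mem_sub sA => x; left|left].
  split=> //; right; apply: jC; apply: fA; [exact: map0|exact: mapA].
- move=> s s0 sD; have [sA|sA] := boolP (all (mem A) s).
    by have [y Ry] := Rex s s0 sA; exists y; left.
  by exists (j (f (map e s))); right.
(* Old codes lie in [A] and new ones in [C], so they never coincide. *)
- have disj s y t : R (s, y) -> all (mem D) t -> t <> [::] ->
      y <> j (f (map e t)).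
    move=> /Rsub[_ yA] tD t0 yE; apply: CnA yA; rewrite yE; apply: jC.
    by apply: fA; [exact: map0|exact: mapA].
  move=> s t y [Rs|[/= s0 sD _ ys]] [Rt|[/= t0 tD _ yt]].
  + exact: Rinj Rs Rt.
  + by case: (disj s y t).
  + by case: (disj t y s).
  + have /finj : f (map e s) = f (map e t).
      by apply: jinj; rewrite ?inE -?ys //; apply: fA;
        [exact: map0|exact: mapA|exact: map0|exact: mapA].
    move=> /(_ (map0 s s0) (mapA s sD) (map0 t t0) (mapA t tD)).
    (* The induction carries along that all letters lie in [D], where [e] is injective. *)
    have : all (mem D) s /\ all (mem D) t by [].
    elim: (s) (t) => [|x u IH] [|z v] //= [/andP[xD uD] /andP[zD vD]] [exz euv].
    by rewrite (einj _ _ xD zD exz) (IH v).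
Qed.

End WordCodes.

(** Zorn's lemma gives a maximal code, and maximality forces its alphabet to be as large as [K]. *)
Lemma card_seq_infinite (K : Type) :
  infinite_set [set: K] -> [set: seq K] #<= [set: K].
Proof.
move=> Kinf; have [k0 _] := infinite_setN0 Kinf.
have /infiniteP/(card_le_ex_inj k0)[g [_ ginj']] := Kinf.
have ginj : injective g by move=> m n; apply: ginj'; rewrite inE.
have [R [Rcode Rmax]] := Zorn_bigcup (@word_code_bigcup K).
set A := code_alphabet R.
(* With an empty alphabet [R] would be empty, and the code of the words over [nat] would strictly
   extend it. *)
have [a0 Aa0] : A !=set0.
  apply/set0P/eqP => A0; have [R0 R0code R0g] := word_code_nat ginj.
  apply: (Rmax R0) => //; split=> [[s y]|R0R].
    by move=> /(let: And3 h _ _ := Rcode in h)[_]; rewrite -/A A0.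
  have : code_alphabet R0 (g 0%N) by rewrite R0g; exists 0%N.
  by move=> /(code_alphabet_sub R0R); rewrite -/A A0.
have [f [fR finj]] := word_code_fun Rcode k0.
have fA s : s <> [::] -> all (mem A) s -> A (f s).
  by move=> s0 /(fR s s0)/(let: And3 h _ _ := Rcode in h)[].
(* If the complement of A is no larger than A, then A has the size of K and
   codes the words over K; otherwise the code can be extended. *)
have [h|h] := card_le_total (~` A) A.
  have [//|//|e [eA einj]] := ex_inj_setU fA finj h.
  rewrite setUv in eA einj.
  (* The leading [a0] keeps the coded word nonempty even when [s] is empty. *)
  apply: (@set_inj_card_le _ _ _ _ (fun s => f (a0 :: map e s))) => //.
  have ok s : all (mem A) (a0 :: map e s).
    rewrite /= mem_set //= all_map -(eq_all (a1 := predT)) ?all_predT // => x.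
    by rewrite /= mem_set //; exact: eA.
  move=> s t _ _ /finj e_eq.
  case: (e_eq _ (ok s) _ (ok t)) => // -[].
  by apply: inj_map => x y; apply: einj; rewrite inE.
(* A copy of [A] inside its complement provides the new letters. *)
have [j [jA jinj]] := card_le_ex_inj k0 h.
have [||| R' [RR' R'code]] := @word_code_extend K R (j @` A) Rcode.
- by exists (j a0); exists a0.
- by move=> _ [x Ax <-]; exact: (jA x Ax).
- exact: (inj_card_eq jinj).
by case: (Rmax R').
Qed.

(** * Size of a generated subgroup *)

Local Open Scope group_scope.

Lemma generated_subgroup_card_le (G : groupType) (S : set G) (K : Type) :
  infinite_set [set: K] -> S `\` [set 1] #<= [set: K] ->
  generated_subgroup S #<= [set: K].
Proof.
move=> Kinf SK; have [k0 _] := infinite_setN0 Kinf.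
have [q [_ qinj]] := card_le_ex_inj k0 SK.
(* [h] undoes [q] on the generators other than 1; indices of no generator may be sent to 1. *)
have /choice[h hP] k : exists x, forall y, (S `\` [set 1]) y -> q y = k -> y = x.
  have [[x Sx <-]|no] := pselect (exists2 x, (S `\` [set 1]) x & q x = k).
    by exists x => y Sy; apply: qinj; rewrite inE.
  by exists 1 => y Sy qy; case: no; exists y.
(* The boolean tells a generator from its inverse. *)
pose letter (p : K * bool) := if p.2 then h p.1 else (h p.1)^-1.
pose eval w := foldr (fun p x => letter p * x) 1 w.
have eval_cat v w : eval (v ++ w) = eval v * eval w.
  by elim: v => [|p v IH] /=; rewrite ?mul1g // IH mulgA.
have eval_inv w : exists v, eval v = (eval w)^-1.
  elim: w => [|[k b] w [v vw]]; first by exists [::]; rewrite /= invg1.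
  exists (v ++ [:: (k, ~~ b)]); rewrite eval_cat vw /= mulg1 invgM /letter /=.
  by case: b; rewrite /= ?invgK.
(* The values of words form a subgroup; a generator equal to 1 is the value of the empty word. *)
have Sgen : generated_subgroup S `<=` range eval.
  apply: smallest_sub => [|x Sx]; last first.
    have [->|x1] := pselect (x = 1); first by exists [::].
    by exists [:: (q x, true)] => //=; rewrite mulg1 /letter /= -(hP _ x).
  split; first by rewrite inE; exists [::].
  move=> _ _ /set_mem[v _ <-] /set_mem[w _ <-].
  have [w' ew'] := eval_inv w.
  by rewrite inE; exists (v ++ w') => //; rewrite eval_cat ew'.
have seqK : [set: seq K] #<= [set: K] := card_seq_infinite Kinf.
(* The length of a word, one or two, encodes the boolean. *)
have KbK : [set: K * bool] #<= [set: K].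
  pose c (p : K * bool) := if p.2 then [:: p.1] else [:: p.1; p.1].
  apply: card_le_trans seqK; apply: (@set_inj_card_le _ _ _ _ c) => //.
  by move=> [k []] [l []] _ _ [] // ->.
have KKb : [set: K] #<= [set: K * bool].
  by apply: (@set_inj_card_le _ _ _ _ (pair ^~ true)) => // k l _ _ [].
apply: card_le_trans (subset_card_le Sgen) _.
apply: card_le_trans (card_image_le _ _) _.
apply: card_le_trans _ KbK; apply: card_seq_infinite => /card_le_finite.
by move=> /(_ _ _ KKb).
Qed.

(** * Discrete subspaces, density and extent *)

Lemma discrete_subspaceS (X : topologicalType) (S C : set X) :
  C `<=` S -> discrete_subspace S -> discrete_subspace C.
Proof.
move=> CS Sdisc B.
(* The open set of [X] that cuts out of [S] the image of [B] also cuts [B] out of [C]. *)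
have [U Uo UB] := Sdisc [set s | exists2 c, B c & val c = val s].
exists U => //; apply/seteqP; split=> [c Uc|c Bc].
  have Sc : val c \in S by rewrite inE; apply: CS; exact/set_mem/(valP c).
  have : (set_val @^-1` U) (SigSub Sc) by [].
  by rewrite UB => -[d Bd /val_inj <-].
have Sc : val c \in S by rewrite inE; apply: CS; exact/set_mem/(valP c).
have : (set_val @^-1` U) (SigSub Sc) by rewrite UB; exists c.
by [].
Qed.

(** The points of [S] outside [B] form a finite, hence closed, set, whose complement cuts out
    [B]. *)
Lemma finite_discrete_subspace (X : topologicalType) (S : set X) :
  accessible_space X -> finite_set S -> discrete_subspace S.
Proof.
move=> T1 Sfin B; exists (~` (S `\` val @` B)).
  apply: closed_openC; move: T1 => /accessible_finite_set_closed; apply.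
  exact: finite_setD.
apply/seteqP; split=> [s|s Bs [_]]; last by apply; exists s.
move=> /= sB; have Ss : S (val s) := set_mem (valP s).
have [b Bb /val_inj <- //] : (val @` B) (val s).
by apply: contrapT => nB; apply: sB.
Qed.

Lemma density_card_le (X : topologicalType) (D : set X) (K : Type) :
  dense D -> D #<= [set: K] -> [set: density X] #<= [set: K].
Proof.
move=> Ddense; apply: card_le_trans.
have [_ /(_ (set_type D)) h] := densityP X.
rewrite (card_le_eqr (card_setT_sym D)); apply: h.
by exists D; split=> //; exact: card_setT_sym.
Qed.

(** A singleton is closed and discrete. With a point of the extent at hand, the pseudocharacter
    embeds in the product of the two. *)
Lemma extent_neq0 (X : topologicalType) :
  accessible_space X -> X -> [set: extent X] !=set0.
Proof.
move=> T1 x; apply/set0P/eqP => E0.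
have : [set x] #<= [set: extent X].
  apply: (extentP X).1; first exact: accessible_closed_set1.
  exact: finite_discrete_subspace.
by rewrite E0 card_le0 => /eqP x0; have : set0 x by rewrite -x0.
Qed.

(** If the extent had n elements, n+1 points would form a closed discrete set too large for it. *)
Lemma infinite_extent (X : topologicalType) :
  accessible_space X -> infinite_set [set: X] -> infinite_set [set: extent X].
Proof.
move=> T1 Xinf; have [x0 _] := infinite_setN0 Xinf.
have /infiniteP/(card_le_ex_inj x0)[g [_ ginj]] := Xinf.
move=> /finite_setP[n En].
have gfin : finite_set (g @` `I_n.+1) by apply/finite_image/finite_II.
have gclosed : closed (g @` `I_n.+1).
  by move: T1 => /accessible_finite_set_closed; apply.
have := (extentP X).1 _ gclosed (finite_discrete_subspace T1 gfin).
have gI : g @` `I_n.+1 #= `I_n.+1.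
  by apply: inj_card_eq => k l _ _; apply: ginj; rewrite inE.
by rewrite (card_le_eqr En) (card_le_eql gI) card_le_II ltnn.
Qed.

(** * From suitable sets to the density *)

Lemma suitable_set_card_le (G : paratopologicalGroupType) (S : set G) :
  accessible_space G -> suitable_set S ->
  S `\` [set 1] #<= [set: (pseudocharacter G * extent G)%type].
Proof.
move=> T1 [Sdisc S1closed _].
have [[Pinf /(_ 1)[F [FP Fopen F1]]] _] := pseudocharacterP T1.
have [p0 _] := infinite_setN0 Pinf.
have [e0 _] := extent_neq0 T1 1.
have F_1 U : F U -> U 1.
  by move=> FU; have : [set (1 : G)] 1 by []; rewrite -F1 => /(_ U FU).
have /choice[i iP] U : exists i : G -> extent G, F U -> set_inj (S `\` U) i.
  have [FU|nFU] := pselect (F U); last by exists (fun=> e0).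
  have SUE : S `\` U #<= [set: extent G].
    apply: (extentP G).1; last by apply: discrete_subspaceS Sdisc => x [].
    have -> : S `\` U = (S `|` [set 1]) `&` ~` U.
      apply/seteqP; split=> [x [Sx nUx]|x [[//|->] /(_ (F_1 U FU))//]].
      by split=> //; left.
    by apply: closedI => //; apply: open_closedC; exact: Fopen.
  by have [i [_ iinj]] := card_le_ex_inj e0 SUE; exists i.
have [q [_ qinj]] := card_le_ex_inj p0 FP.
have /choice[V VP] x : exists U, (S `\` [set 1]) x -> F U /\ ~ U x.
  have [[Sx x1]|nSx] := pselect ((S `\` [set 1]) x); last by exists setT.
  apply: contrapT => /forallNP noU; apply: x1; rewrite -F1 => U FU.
  by apply: contrapT => nUx; apply: (noU U).
(* The first coordinate names a member of [F] that misses [x], the second numbers [x] within the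
   piece of [S] outside it. *)
apply: (@set_inj_card_le _ _ _ _ (fun x => (q (V x), i (V x) x))) => // x y.
rewrite !inE => Sx Sy [].
have [FVx nVx] := VP x Sx; have [FVy nVy] := VP y Sy.
move=> /qinj; rewrite !inE => /(_ FVx FVy) Vxy; rewrite -Vxy in nVy *.
by apply: iP; rewrite ?inE //; split=> //; [case: Sx|case: Sy].
Qed.

Theorem proposition5p9 (G : paratopologicalGroupType) :
  accessible_space G ->
  ((exists S : set G, suitable_set S) ->
     [set: density G] #<= [set: (pseudocharacter G * extent G)%type]) /\
  ((exists S : set G, closed_suitable_set S) ->
     [set: density G] #<= [set: extent G]).
Proof.
move=> T1; split=> [[S Ssuit]|[S [[Sdisc _ Sdense] Sclosed]]].
  have SPE := suitable_set_card_le T1 Ssuit; case: Ssuit => _ _ Sdense.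
  apply: density_card_le Sdense _; apply: generated_subgroup_card_le SPE.
  have [[Pinf _] _] := pseudocharacterP T1.
  have [e0 _] := extent_neq0 T1 1.
  move=> /card_le_finite PEfin; apply: Pinf; apply: PEfin.
  by apply: (@set_inj_card_le _ _ _ _ (pair ^~ e0)) => // p r _ _ [].
(* Counting words requires an infinite cardinal; a finite [G] is itself a closed discrete dense
   set. *)
have [Gfin|Ginf] := pselect (finite_set [set: G]).
  have GE : [set: G] #<= [set: extent G].
    by apply: (extentP G).1; [exact: closedT|exact: finite_discrete_subspace].
  by apply: density_card_le GE => O [x Ox] _; exists x.
apply: density_card_le Sdense _; apply: generated_subgroup_card_le.
  exact: infinite_extent.
apply: card_le_trans (card_le_setD _ _) _.
exact: (extentP G).1.
Qed.
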